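(* Let $\mathfrak{c}=2^{\omega}$ be the cardinality of the continuum. There exists an embedding $\phi\colon H(2^{\mathfrak{c}})/\triangle_H\to P(\omega)/\triangle_d$ such that $d(\phi(a))=\mu(a)$ for every $a\in H(2^{\mathfrak{c}})/\triangle_H$.
   Context: $\omega$ is the set of non-negative integers. For $A\subseteq\omega$, $d_*(A)=\liminf_{n\to\infty}\frac{|A\cap n|}{n}$ and $d^*(A)=\limsup_{n\to\infty}\frac{|A\cap n|}{n}$ (where $n=\{0,\dots,n-1\}$); if they are equal, the common value $d(A)$ is the asymptotic density of $A$. $\triangle_d$ is the ideal of subsets of $\omega$ of asymptotic density zero and $P(\omega)/\triangle_d$ is the quotient Boolean algebra. For $x=[A]\in P(\omega)/\triangle_d$, $d(x)$ means $d(A)$ (existence and value of the density do not depend on the representative); in particular $d(\phi(a))=\mu(a)$ includes the assertion that the density exists. An embedding is an injective homomorphism of Boolean algebras. For an infinite cardinal $\kappa$, $\mu$ is the Haar measure on the Cantor cube $2^{\kappa}=\{0,1\}^{\kappa}$, generated by the basic sets $[s]=\{f\in\{0,1\}^{\kappa}: s\subseteq f\}$, $s$ a finite partial function from $\kappa$ to $\{0,1\}$, with $\mu([s])=\frac{1}{2^{|s|}}$. $H(2^{\kappa})$ is the family of all Haar measurable subsets of $2^{\kappa}$ and $\triangle_H$ is the ideal of sets of Haar measure zero; $\mu(a)$ for $a=[B]\in H(2^{\kappa})/\triangle_H$ is $\mu(B)$. *)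

(* Defs.v *)
From HB Require Import structures.
From mathcomp Require Import all_boot all_order all_algebra finmap.
From mathcomp Require Import all_classical all_reals all_analysis.

Set Implicit Arguments.
Unset Strict Implicit.
Unset Printing Implicit Defensive.

Import Order.Theory GRing.Theory Num.Theory.
Import numFieldNormedType.Exports.

Local Open Scope classical_set_scope.
Local Open Scope quotient_scope.
Local Open Scope ring_scope.

Section BooleanQuotient.
Local Open Scope order_scope.

Record boolean_ideal d (B : ctbDistrLatticeType d) := BooleanIdeal {
  ideal_set : set B ;
  ideal_bot : ideal_set \bot ;
  ideal_join : forall x y, ideal_set x -> ideal_set y -> ideal_set (x `|` y) ;
  ideal_le : forall x y, x <= y -> ideal_set y -> ideal_set x }.

Context {d : Order.disp_t} {B : ctbDistrLatticeType d} (I : boolean_ideal B).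
Implicit Types x y z : B.

Definition ideal_rel : rel B :=
  fun x y => `[< ideal_set I ((x `\` y) `|` (y `\` x)) >].

Lemma ideal_relP x y :
  reflect (exists2 z, ideal_set I z & x `|` z = y `|` z) (ideal_rel x y).
Proof.
apply: (iffP (asboolP _)) => [Ixy|[z Iz xzyz]].
  exists ((x `\` y) `|` (y `\` x)) => //.
  rewrite [in LHS](joinC (x `\` y)) [in LHS]joinA diffKU.
  rewrite [in RHS]joinA diffKU (joinC y x).
  rewrite [RHS]join_l; last by rewrite (le_trans (leBx _ _)) ?leUr.
  by rewrite join_l // (le_trans (leBx _ _))// leUl.
apply: (ideal_le _ Iz); rewrite leUx !leBLR.
by rewrite -xzyz leUl/= xzyz leUl.
Qed.

Lemma ideal_rel_refl : reflexive ideal_rel.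
Proof. by move=> x; apply/ideal_relP; exists \bot => //; exact: ideal_bot. Qed.

Lemma ideal_rel_sym : symmetric ideal_rel.
Proof. by move=> x y; rewrite /ideal_rel joinC. Qed.

Lemma ideal_rel_trans : transitive ideal_rel.
Proof.
move=> y x t /ideal_relP[z Iz xy] /ideal_relP[w Iw yt].
apply/ideal_relP; exists (z `|` w); first exact: ideal_join.
by rewrite joinA xy joinAC yt joinAC joinA.
Qed.

Canonical ideal_equiv :=
  EquivRel ideal_rel ideal_rel_refl ideal_rel_sym ideal_rel_trans.

Definition boolean_quotient := {eq_quot ideal_equiv}.

HB.instance Definition _ := Choice.on boolean_quotient.
HB.instance Definition _ := EqQuotient.on boolean_quotient.

Definition quot_meet := lift_op2 boolean_quotient (@Order.meet d B).
Definition quot_join := lift_op2 boolean_quotient (@Order.join d B).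
Definition quot_compl := lift_op1 boolean_quotient (@Order.compl d B).

Lemma pi_quot_join :
  {morph \pi_boolean_quotient : x y / x `|` y >-> quot_join x y}.
Proof.
unlock quot_join => x y; apply/eqmodP/ideal_relP.
have /eqmodP/ideal_relP[z Iz xz] := reprK (\pi_boolean_quotient x).
have /eqmodP/ideal_relP[w Iw yw] := reprK (\pi_boolean_quotient y).
exists (z `|` w); first exact: ideal_join.
by rewrite joinACA -xz -yw joinACA.
Qed.

Lemma pi_quot_meet :
  {morph \pi_boolean_quotient : x y / x `&` y >-> quot_meet x y}.
Proof.
unlock quot_meet => x y; apply/eqmodP/ideal_relP.
have /eqmodP/ideal_relP[z Iz xz] := reprK (\pi_boolean_quotient x).
have /eqmodP/ideal_relP[w Iw yw] := reprK (\pi_boolean_quotient y).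
exists (z `|` w); first exact: ideal_join.
rewrite !joinIl !joinA -xz; congr (_ `&` _).
by rewrite !(joinAC _ z) -yw.
Qed.

Lemma pi_quot_compl :
  {morph \pi_boolean_quotient : x / ~` x >-> quot_compl x}.
Proof.
unlock quot_compl => x; apply/eqmodP/ideal_relP.
have /eqmodP/ideal_relP[z Iz xz] := reprK (\pi_boolean_quotient x).
have C y : ~` y `|` z = ~` (y `|` z) `|` z.
  by rewrite complU joinIl [~` z `|` z]joinC joinxC meetx1.
by exists z => //; rewrite C -xz -C.
Qed.

Fact quot_display : Order.disp_t. Proof. exact: Order.Disp tt tt. Qed.

Local Notation Q := boolean_quotient.
Local Notation pi := (\pi_boolean_quotient).

Fact quot_meetC : commutative quot_meet.
Proof. by elim/quotW => x; elim/quotW => y; rewrite -!pi_quot_meet meetC. Qed.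
Fact quot_joinC : commutative quot_join.
Proof. by elim/quotW => x; elim/quotW => y; rewrite -!pi_quot_join joinC. Qed.
Fact quot_meetA : associative quot_meet.
Proof.
elim/quotW => x; elim/quotW => y; elim/quotW => z.
by rewrite -!pi_quot_meet meetA.
Qed.
Fact quot_joinA : associative quot_join.
Proof.
elim/quotW => x; elim/quotW => y; elim/quotW => z.
by rewrite -!pi_quot_join joinA.
Qed.
Fact quot_joinKI (y x : Q) : quot_meet x (quot_join x y) = x.
Proof.
by elim/quotW: x => x; elim/quotW: y => y; rewrite -pi_quot_join -pi_quot_meet joinKI.
Qed.
Fact quot_meetKU (y x : Q) : quot_join x (quot_meet x y) = x.
Proof.
by elim/quotW: x => x; elim/quotW: y => y; rewrite -pi_quot_meet -pi_quot_join meetKU.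
Qed.
Fact quot_meetUl : left_distributive quot_meet quot_join.
Proof.
elim/quotW => x; elim/quotW => y; elim/quotW => z.
by rewrite -pi_quot_join -!pi_quot_meet -pi_quot_join meetUl.
Qed.
Fact quot_meetxx : idempotent_op quot_meet.
Proof. by elim/quotW => x; rewrite -pi_quot_meet meetxx. Qed.

HB.instance Definition _ := @Order.isMeetJoinDistrLattice.Build quot_display Q
  (fun p q => quot_meet p q == p) (fun p q => (q != p) && (quot_meet p q == p))
  quot_meet quot_join (fun _ _ => erefl) (fun _ _ => erefl)
  quot_meetC quot_joinC quot_meetA quot_joinA quot_joinKI quot_meetKU
  quot_meetUl quot_meetxx.

Fact quot_le0x (x : Q) : pi \bot <= x.
Proof.
by elim/quotW: x => x; apply/eqP; rewrite [LHS](esym (pi_quot_meet _ _)) meet0x.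
Qed.
Fact quot_lex1 (x : Q) : x <= pi \top.
Proof.
by elim/quotW: x => x; apply/eqP; rewrite [LHS](esym (pi_quot_meet _ _)) meetx1.
Qed.

HB.instance Definition _ := Order.hasBottom.Build quot_display Q quot_le0x.
HB.instance Definition _ := Order.hasTop.Build quot_display Q quot_lex1.

Fact quot_joinxC (x : Q) : x `|` quot_compl x = \top.
Proof.
elim/quotW: x => x.
by rewrite -pi_quot_compl [LHS](esym (pi_quot_join _ _)) joinxC.
Qed.
Fact quot_meetxC (x : Q) : x `&` quot_compl x = \bot.
Proof.
elim/quotW: x => x.
by rewrite -pi_quot_compl [LHS](esym (pi_quot_meet _ _)) meetxC.
Qed.

HB.instance Definition _ := Order.TBDistrLattice_hasComplement.Build
  quot_display Q quot_joinxC quot_meetxC.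

End BooleanQuotient.

Section BooleanEmbedding.
Local Open Scope order_scope.

Definition boolean_embedding d1 d2 (B1 : ctbDistrLatticeType d1)
    (B2 : ctbDistrLatticeType d2) (phi : B1 -> B2) : Prop :=
  [/\ injective phi,
      {morph phi : x y / x `&` y}, {morph phi : x y / x `|` y},
      {morph phi : x / ~` x} & phi \bot = \bot /\ phi \top = \top].

End BooleanEmbedding.

Section MeasurableSets.
Context {d : measure_display} (T : measurableType d).

Definition measurable_pred : pred (set T) := fun A => `[< measurable A >].

Record measurable_sets :=
  MeasurableSet { mset_val :> set T ; _ : measurable_pred mset_val }.

HB.instance Definition _ := [isSub for mset_val].
HB.instance Definition _ := [Choice of measurable_sets by <:].

Fact measurable_predI : {in measurable_pred &, forall A B, (A `&` B)%O \in measurable_pred}.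
Proof.
by move=> A B /asboolP mA /asboolP mB; apply/asboolP; exact: measurableI.
Qed.
Fact measurable_predU : {in measurable_pred &, forall A B, (A `|` B)%O \in measurable_pred}.
Proof.
by move=> A B /asboolP mA /asboolP mB; apply/asboolP; exact: measurableU.
Qed.
Fact measurable_pred0 : (\bot%O : set T) \in measurable_pred.
Proof. by apply/asboolP; exact: measurable0. Qed.
Fact measurable_predT : (\top%O : set T) \in measurable_pred.
Proof. by apply/asboolP; exact: measurableT. Qed.
Fact measurable_predC (A : measurable_sets) : measurable_pred (~` mset_val A).
Proof. by have /asboolP mA := valP A; apply/asboolP; exact: measurableC. Qed.

Fact measurable_sets_display : Order.disp_t. Proof. exact: Order.Disp tt tt. Qed.

HB.instance Definition _ := Order.SubChoice_isTBSubLattice.Build _ (set T)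
  measurable_pred measurable_sets_display measurable_sets
  measurable_predI measurable_predU measurable_pred0 measurable_predT.

Fact mset_meetUl :
  @left_distributive measurable_sets measurable_sets Order.meet Order.join.
Proof. by move=> A B C; apply: val_inj; exact: setIUl. Qed.

HB.instance Definition _ := Order.Lattice_Meet_isDistrLattice.Build
  measurable_sets_display measurable_sets mset_meetUl.

Definition mset_compl (A : measurable_sets) := MeasurableSet (measurable_predC A).

Fact mset_joinxC A : (A `|` mset_compl A = \top)%O.
Proof. by apply: val_inj; exact: setUv. Qed.
Fact mset_meetxC A : (A `&` mset_compl A = \bot)%O.
Proof. by apply: val_inj; exact: setICr. Qed.

HB.instance Definition _ := Order.TBDistrLattice_hasComplement.Build
  measurable_sets_display measurable_sets mset_joinxC mset_meetxC.

End MeasurableSets.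

Section MeasureAlgebra.
Context {d : measure_display} {T : measurableType d} {R : realType}.
Variable mu : {measure set T -> \bar R}.
Local Open Scope ereal_scope.

Let null : set (measurable_sets T) := [set A | mu A = 0].

Lemma msetP (A : measurable_sets T) : measurable (A : set T).
Proof. by have /asboolP := valP A. Qed.
Let null_bot : null \bot%O.
Proof. exact: measure0. Qed.
Let null_join A B : null A -> null B -> null (A `|` B)%O.
Proof. exact: null_set_setU (msetP A) (msetP B). Qed.
Let null_le A B : (A <= B)%O -> null B -> null A.
Proof.
move=> /meet_idPl /(congr1 val) /setIidPl AB B0.
by apply: (subset_measure0 _ _ AB) => //; exact: msetP.
Qed.

Definition null_ideal := BooleanIdeal null_bot null_join null_le.

Definition measure_algebra := boolean_quotient null_ideal.
HB.instance Definition _ := Order.CTBDistrLattice.on measure_algebra.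
HB.instance Definition _ := EqQuotient.on measure_algebra.

Definition algebra_measure (a : measure_algebra) : \bar R := mu (repr a).

Lemma algebra_measureE (A : measurable_sets T) :
  algebra_measure (\pi_measure_algebra A) = mu A.
Proof.
have /eqmodP/ideal_relP[Z Z0 AZ] := reprK (\pi_measure_algebra A).
rewrite /algebra_measure -[LHS](measureU0 _ (msetP Z) Z0); last exact: msetP.
rewrite -[RHS](measureU0 _ (msetP Z) Z0); last exact: msetP.
by congr (mu _); exact: (congr1 val AZ).
Qed.

End MeasureAlgebra.

Section Density.
Variable R : realType.
Implicit Types (A B : set nat) (l : \bar R).

(* For n = 0 the quotient is 0 / 0 = 0, which does not affect the limits. *)
Definition density_ratio A (n : nat) : R := #|` fset_set (A `&` `I_n)|%:R / n%:R.

Definition lower_density A : \bar R := limn_einf (fun n => (density_ratio A n)%:E).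
Definition upper_density A : \bar R := limn_esup (fun n => (density_ratio A n)%:E).

Definition has_density A l := lower_density A = l /\ upper_density A = l.

Local Open Scope ereal_scope.

Lemma has_densityP A l :
  has_density A l <-> (density_ratio A n)%:E @[n --> \oo] --> l.
Proof.
split=> [[infl supl]|]; last by move/cvg_limn_einf_sup => -[].
set u := fun n => _; have uE n : einfs u n <= u n <= esups u n.
  by rewrite ereal_inf_lbound ?ereal_sup_ubound//; exists n => /=.
apply: (@squeeze_cvge _ _ _ _ (einfs u) _ (esups u)).
- exact: nearW.
- by rewrite -infl /lower_density limn_einf_lim; exact: is_cvg_einfs.
- by rewrite -supl /upper_density limn_esup_lim; exact: is_cvg_esups.
Qed.

Lemma density_ratio_ge0 A n : (0 <= density_ratio A n)%R.
Proof. by rewrite divr_ge0. Qed.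

Lemma density_ratio_le A B n :
  A `<=` B -> (density_ratio A n <= density_ratio B n)%R.
Proof.
move=> AB; rewrite ler_wpM2r ?invr_ge0// ler_nat fsubset_leq_card//.
rewrite -fset_set_sub; first by exact: setSI.
- exact: finite_setIr.
- exact: finite_setIr.
Qed.

Lemma density_ratioU A B n :
  (density_ratio (A `|` B) n <= density_ratio A n + density_ratio B n)%R.
Proof.
rewrite -mulrDl ler_wpM2r ?invr_ge0// -natrD ler_nat setIUl fset_setU.
- by rewrite cardfsU leq_subr.
- exact: finite_setIr.
- exact: finite_setIr.
Qed.

Let null : set (set nat) := [set A | has_density A 0].

Let null_le A B : (A <= B)%O -> null B -> null A.
Proof.
move=> /subsetPset AB /has_densityP B0; apply/has_densityP.
apply: (@squeeze_cvge _ _ _ _ (cst 0) _ (fun n => (density_ratio B n)%:E)) => //.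
- by apply: nearW => n; rewrite !lee_fin density_ratio_ge0 density_ratio_le.
- exact: cvg_cst.
Qed.

Let null_bot : null \bot%O.
Proof.
apply/has_densityP; rewrite (_ : (fun _ => _) = cst 0); first exact: cvg_cst.
by apply/funext => n; rewrite /density_ratio set0I fset_set0 cardfs0 mul0r.
Qed.

Let null_join A B : null A -> null B -> null (A `|` B)%O.
Proof.
move=> /has_densityP A0 /has_densityP B0; apply/has_densityP.
apply: (@squeeze_cvge _ _ _ _ (cst 0) _
  (fun n => (density_ratio A n)%:E + (density_ratio B n)%:E)) => //.
- apply: nearW => n; rewrite -EFinD !lee_fin density_ratio_ge0.
  exact: density_ratioU.
- exact: cvg_cst.
- by rewrite -[X in _ --> X](adde0 0); apply: cvgeD.
Qed.

Definition density_zero_ideal := BooleanIdeal null_bot null_join null_le.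

Definition density_algebra := boolean_quotient density_zero_ideal.
HB.instance Definition _ := Order.CTBDistrLattice.on density_algebra.
HB.instance Definition _ := EqQuotient.on density_algebra.

Definition algebra_has_density (x : density_algebra) l := has_density (repr x) l.

Lemma algebra_has_densityE A l :
  algebra_has_density (\pi_density_algebra A) l <-> has_density A l.
Proof.
suff H X Y : \pi_density_algebra X = \pi_density_algebra Y ->
    has_density X l -> has_density Y l.
  by split; apply: H; rewrite reprK.
move=> /eqmodP/ideal_relP[Z /has_densityP Z0 XZ] /has_densityP Xl.
apply/has_densityP.
apply: (@squeeze_cvge _ _ _ _
  (fun n => (density_ratio X n)%:E - (density_ratio Z n)%:E) _
  (fun n => (density_ratio X n)%:E + (density_ratio Z n)%:E)).
- apply: nearW => n; rewrite -EFinN -!EFinD !lee_fin lerBlDr.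
  have le U V : (U `|` Z = V `|` Z)%O ->
      (density_ratio U n <= density_ratio V n + density_ratio Z n)%R.
    move=> UV; apply: le_trans (density_ratioU V Z n).
    by apply: density_ratio_le; rewrite -[V `|` Z]/(V `|` Z)%O -UV; exact: subsetUl.
  by rewrite !le.
- by rewrite -[X in _ --> X]sube0; apply: cvgeB => //; rewrite oppe0 fin_num_adde_defl.
- by rewrite -[X in _ --> X]adde0; apply: cvgeD => //; rewrite fin_num_adde_defl.
Qed.

End Density.

Section HaarMeasure.
Variables (K : choiceType) (R : realType).
Implicit Types (s : {fmap K -> bool}) (X : set (K -> bool)).
Local Open Scope ereal_scope.

Definition basic_set s : set (K -> bool) :=
  [set f | forall k b, s.[? k]%fmap = Some b -> f k = b].

Definition basic_weight s : \bar R := (2 ^- #|` domf s|)%:E.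

(* The outer measure generated by mu([s]) = 2 ^- |s|: infimum of the total
   weight over the (finite or infinite) countable covers by basic sets. *)
Definition haar_outer X : \bar R :=
  ereal_inf [set \esum_(s in C) basic_weight s |
    C in [set C | countable C /\ X `<=` \bigcup_(s in C) basic_set s]].

Lemma basic_weight_ge0 s : 0 <= basic_weight s.
Proof. by rewrite lee_fin invr_ge0 exprn_ge0. Qed.

Lemma haar_outer0 : haar_outer set0 = 0.
Proof.
apply/eqP; rewrite eq_le; apply/andP; split.
- apply: ereal_inf_lbound; exists set0; last exact: esum_set0.
  by split; [exact: countable0|exact: sub0set].
- apply: le_ereal_inf_tmp => _ [C _ <-].
  by apply: esum_ge0 => s _; exact: basic_weight_ge0.
Qed.

Lemma haar_outer_ge0 X : 0 <= haar_outer X.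
Proof.
apply: le_ereal_inf_tmp => _ [C _ <-].
by apply: esum_ge0 => s _; exact: basic_weight_ge0.
Qed.

Lemma le_haar_outer : {homo haar_outer : X Y / X `<=` Y >-> X <= Y}.
Proof.
move=> X Y XY; apply: ereal_inf_le_tmp => _ [C [cC YC] <-].
by exists C => //; split => //; exact: subset_trans YC.
Qed.

Lemma haar_outer_sigma_subadditive : sigma_subadditive haar_outer.
Proof.
move=> A; have [[i ioo]|] := pselect (exists i, haar_outer (A i) = +oo).
  rewrite (eseries_pinfty _ _ ioo) ?leey// => n _.
  by rewrite -ltNye (lt_le_trans _ (haar_outer_ge0 _)).
rewrite -forallNE => Aoo.
suff add2e (e : {posnum R}) : haar_outer (\bigcup_n A n) <=
    \sum_(i <oo) haar_outer (A i) + e%:num%:E.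
  by apply/lee_addgt0Pr => _/posnumP[].
rewrite (le_trans _ (epsilon_trick _ _ _))//; last first.
  by move=> n; exact: haar_outer_ge0.
pose P n (C : set {fmap K -> bool}) :=
  [/\ countable C, A n `<=` \bigcup_(s in C) basic_set s &
   \esum_(s in C) basic_weight s <=
     haar_outer (A n) + (e%:num / (2 ^ n.+1)%:R)%:E].
have [G PG] : {G : nat -> set {fmap K -> bool} & forall n, P n (G n)}.
  apply: (@choice _ _ P) => n; rewrite /P.
  have fA : haar_outer (A n) \is a fin_num.
    by rewrite ge0_fin_numE ?haar_outer_ge0// ltey; apply/eqP; exact: Aoo.
  have en1 : (0 < e%:num / (2 ^ n.+1)%:R :> R)%R by [].
  have [_ [C [cC AC] <-] /ltW CA] := lb_ereal_inf_adherent en1 fA.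
  by exists C.
apply: (@le_trans _ _ (\esum_(s in \bigcup_n G n) basic_weight s)).
  apply: ereal_inf_lbound; exists (\bigcup_n G n) => //; split.
    by apply: bigcup_countable => // n _; have [] := PG n.
  move=> f [n _ Anf]; have [_ /(_ f Anf)[s Gs fs] _] := PG n.
  by exists s => //; exists n.
rewrite seqDU_bigcup_eq nneseries_sum_bigcup; last 2 first.
- exact: trivIset_seqDU.
- exact: basic_weight_ge0.
apply: lee_nneseries => [n _ _|n _].
  by apply: esum_ge0 => s _; exact: basic_weight_ge0.
have [_ _] := PG n; apply: le_trans; rewrite esum_mkcond [leRHS]esum_mkcond.
apply: le_esum => s _; case: ifPn => [|_].
  by move=> /set_mem Gs; rewrite (mem_set (@subset_seqDU _ _ _ _ Gs)).
by case: ifPn => // _; exact: basic_weight_ge0.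
Qed.

HB.instance Definition _ := isOuterMeasure.Build R (K -> bool) haar_outer
  haar_outer0 haar_outer_ge0 le_haar_outer haar_outer_sigma_subadditive.

(* The Haar measurable sets are the Caratheodory measurable sets of
   [haar_outer], that is, the domain of the completion of the measure
   generated by the basic sets. *)
Definition cantor_cube := caratheodory_type haar_outer.
HB.instance Definition _ := Measurable.on cantor_cube.

Definition haar_measure : set cantor_cube -> \bar R := haar_outer.
HB.instance Definition _ := isMeasure.Build _ cantor_cube R haar_measure
  (@caratheodory_measure0 _ _ haar_outer)
  (@caratheodory_measure_ge0 _ _ haar_outer)
  (@caratheodory_measure_sigma_additive _ _ haar_outer).

End HaarMeasure.

Arguments haar_measure K R _ : clear implicits.

(* Main.v *)
From HB Require Import structures.
Require Import Defs.
From mathcomp Require Import all_boot all_order all_algebra finmap.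
From mathcomp Require Import all_classical all_reals all_analysis.
From mathcomp Require Import lra zify.

(** Call a sequence [f] of points of the cube uniformly distributed if, for
    every clopen [C], the set [f @^-1` C] of visiting times has density the
    Haar measure of [C]. For such [f] the map [C |-> f @^-1` C] is a
    density-preserving Boolean homomorphism on clopen sets, isometric for the
    measure and the upper density of symmetric differences. Clopen sets are
    dense in the measure algebra ([measurable_clopen_dense]) and the subsets of
    [nat] are complete for upper density ([upper_density_complete]), so the map
    extends by continuity to all measurable sets. The extension is still a
    homomorphism, still sends measure to density, and is injective because a
    set of positive measure goes to a set of positive density
    ([density_embedding]).

    It remains to find [f]. Identify the coordinates with distinct infinite
    binary sequences; this is possible since there are no more than continuum
    many. At stage [k] let the points run cyclically through all [2 ^ 2 ^ k]
    functions from binary words of length [k] to [bool], the value of such a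
    point at a coordinate being determined by the first [k] bits of that
    coordinate. Finitely many coordinates eventually have distinct initial
    words, and from then on every pattern of values on them occurs exactly
    equally often in each period. If stage [k] occupies the integers from
    [4 ^ 2 ^ k] to [4 ^ 2 ^ k.+1], the period is negligible compared with the
    position, and the visits to a basic set constraining [n] coordinates have
    density [2 ^- n] ([stage_point_basic], as an upper bound).

    The upper bound on basic sets suffices. A closed set is compact, so its
    covers by basic sets may be taken finite, which bounds the frequency of
    visits by the outer measure ([closed_density_ratio]). Applied to a clopen
    set and to its complement, whose measures add up to at most [1], this
    forces equality ([clopen_has_density]). *)

Set Implicit Arguments.
Unset Strict Implicit.
Unset Printing Implicit Defensive.
Import Order.Theory GRing.Theory Num.Theory.
Import numFieldNormedType.Exports.
Local Open Scope classical_set_scope.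
Local Open Scope ring_scope.

(** * Frequencies and upper density *)

Section DensityRatio.
Variable R : realType.
Implicit Types A B : set nat.

Lemma density_ratio_leI A B n :
  A `&` `I_n `<=` B -> density_ratio R A n <= density_ratio R B n.
Proof.
move=> AB; have -> : density_ratio R A n = density_ratio R (A `&` `I_n) n.
  by rewrite /density_ratio -setIA setIid.
exact: density_ratio_le.
Qed.

Lemma density_ratioE A n :
  density_ratio R A n = (\sum_(i < n) (val i \in A))%:R / n%:R.
Proof.
congr (_%:R / _).
have /perm_size -> : perm_eq (fset_set (A `&` `I_n)) [seq i <- iota 0 n | i \in A].
  apply: uniq_perm; rewrite ?fset_uniq ?filter_uniq ?iota_uniq// => i.
  rewrite in_fset_set; last exact: finite_setIr.
  rewrite mem_filter mem_iota/= add0n in_setI; congr (_ && _).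
  by apply/idP/idP => [/set_mem|/mem_set].
rewrite size_filter -sumn_count sumnE big_map.
by rewrite -(big_mkord xpredT (fun i => nat_of_bool (i \in A))) /index_iota subn0.
Qed.

Lemma density_ratioC A n : (0 < n)%N ->
  density_ratio R (~` A) n = 1 - density_ratio R A n.
Proof.
move=> n0; apply/eqP; rewrite eq_sym subr_eq eq_sym.
rewrite !density_ratioE -mulrDl -natrD -big_split/=.
rewrite (eq_bigr (fun=> 1%N)) => [|i _]; last by rewrite in_setC; case: (_ \in A).
by rewrite sum1_card card_ord divff// pnatr_eq0 -lt0n.
Qed.

(** Symmetric differences control densities; this is what makes the density
    pass to limits in the upper density pseudometric. *)
Lemma density_ratio_dist A B n :
  `|density_ratio R A n - density_ratio R B n| <= density_ratio R (A `+` B) n.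
Proof.
have H C D : density_ratio R C n <= density_ratio R D n + density_ratio R (C `+` D) n.
  apply: le_trans (density_ratioU _ _ _ _); apply: density_ratio_le => x Cx.
  by have [Dx|nDx] := pselect (D x); [left|right; left].
rewrite ler_distl; apply/andP; split; first by rewrite lerBlDr setYC H.
exact: H.
Qed.

Lemma has_density_fin A (l : R) :
  has_density A l%:E <-> density_ratio R A n @[n --> \oo] --> l.
Proof.
rewrite has_densityP; split => [/fine_cvgP[_]//|Al].
by apply/fine_cvgP; split => //; exact: nearW.
Qed.

Lemma has_density_unique A (l l' : \bar R) :
  has_density A l -> has_density A l' -> l = l'.
Proof. by move=> [<- _] [<- _]. Qed.

Lemma finite_density_ratio A (e : R) : finite_set A -> 0 < e ->
  \forall n \near \oo, density_ratio R A n <= e.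
Proof.
move=> fA e0; near=> n.
have n0 : (0 < n)%N by near: n; exact: nbhs_infty_gt.
rewrite /density_ratio ler_pdivrMr ?ltr0n//.
apply: (@le_trans _ _ #|` fset_set A|%:R); last first.
  by rewrite -ler_pdivrMl// mulrC; near: n; exact: nbhs_infty_ger.
rewrite ler_nat fsubset_leq_card// -fset_set_sub//; exact: finite_setIr.
Unshelve. all: by end_near. Qed.

End DensityRatio.

Section Completeness.
Variable R : realType.

Lemma density_ratio_bigU (I : Type) (s : seq I) (P : pred I) (E : I -> set nat) n :
  density_ratio R (\big[setU/set0]_(i <- s | P i) E i) n <=
  \sum_(i <- s | P i) density_ratio R (E i) n.
Proof.
apply: (big_ind2 (fun A x => density_ratio R A n <= x)) => //.
- by rewrite density_ratioE big1 ?mul0r// => i _; rewrite in_set0.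
- move=> A x B y Ax By; apply: le_trans (density_ratioU _ _ _ _) _.
  exact: lerD.
Qed.

Lemma setY_telescope (T : Type) (D : nat -> set T) j i x : (j <= i)%N ->
  (D i `+` D j) x -> exists2 l, (j <= l < i)%N & (D l `+` D l.+1) x.
Proof.
move=> ji; elim: i ji => [|i IH]; first by rewrite leqn0 => /eqP ->; rewrite setYK.
rewrite leq_eqVlt => /predU1P[<-|]; first by rewrite setYK.
rewrite ltnS => ji Dx.
have [|nDx] := pselect ((D i `+` D i.+1) x); first by exists i => //; rewrite ji leqnn.
have [] := IH ji; last first.
  by move=> l /andP[jl li] Dl; exists l => //; rewrite jl ltnW.
rewrite !setY_def/= in Dx nDx *.
have [?|?] := pselect (D i x); have [?|?] := pselect (D i.+1 x);
 have [?|?] := pselect (D j x); rewrite /setD/=; tauto.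
Qed.

Lemma sum_half_le j n : \sum_(j <= l < n) (2 ^- l : R) <= 2 * 2 ^- j.
Proof.
have [nj|jn] := leqP n j; first by rewrite big_geq.
suff : \sum_(j <= l < n) (2 ^- l : R) = 2 * 2 ^- j - 2 * 2 ^- n.
  by move=> ->; rewrite gerBl.
elim: n jn => // n IH; rewrite ltnS leq_eqVlt => /predU1P[->|jn].
  by rewrite big_nat1 exprS invfM//; lra.
rewrite big_nat_recr ?IH//=; last exact: ltnW.
by rewrite exprS invfM//; lra.
Qed.

(** Completeness for upper density, by gluing: the limit of the fast Cauchy
    sequence [D] is obtained by following [D l] on [[M l, M l.+1[], where the threshold
    [M l] is so large that from there on [D l] and [D l.+1] differ by a
    proportion of at most [2 ^- l]. An initial segment of length [m] then meets
    only the differences [D l `+` D l.+1] with [M l <= m], and the proportions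
    of those are summable. *)
Lemma upper_density_complete (D : nat -> set nat) :
  (forall n, \forall m \near \oo, density_ratio R (D n `+` D n.+1) m <= 2 ^- n) ->
  exists A, forall j,
    \forall m \near \oo, density_ratio R (A `+` D j) m <= 3 * 2 ^- j.
Proof.
move=> cauchyD.
have [N HN] : exists N : nat -> nat, forall n m, (N n <= m)%N ->
    density_ratio R (D n `+` D n.+1) m <= 2 ^- n.
  suff /choice[N HN] : forall n, exists N, forall m, (N <= m)%N ->
      density_ratio R (D n `+` D n.+1) m <= 2 ^- n by exists N.
  by move=> n; have [N _ HN] := cauchyD n; exists N.
(* the summand [n] makes [M] dominate its index, so that the maximum in [lev]
   below ranges over a bounded set *)
pose M n := (n + \sum_(i < n.+1) N i)%N.
have MN n : (N n <= M n)%N by rewrite /M big_ord_recr/= addnA leq_addl.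
have Mge n : (n <= M n)%N by rewrite leq_addr.
have Mle : {homo M : n m / (n <= m)%N}.
  apply: homo_leq => [n|y x z|n]; [exact: leqnn|exact: leq_trans|].
  by rewrite /M [in leqRHS]big_ord_recr /= leq_add ?leq_addr.
pose lev x := (\max_(l < x.+1 | M l <= x) l)%N.
have lev_ge l x : (M l <= x)%N -> (l <= lev x)%N.
  move=> Mlx; have lx : (l < x.+1)%N by rewrite ltnS (leq_trans (Mge _) Mlx).
  exact: (@leq_bigmax_cond _ (fun i : 'I_x.+1 => M i <= x)%N val (Ordinal lx)).
have lev_le x : (0 < lev x)%N -> (M (lev x) <= x)%N.
  rewrite /lev; elim/big_ind : _ => // a b; rewrite /maxn; case: ifP => //.
(* [lev x] is the index of the block containing [x] *)
exists [set x | D (lev x) x] => j; near=> m.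
apply: (@le_trans _ _ (density_ratio R (`I_(M j) `|`
   \big[setU/set0]_(j <= l < m | (M l <= m)%N) (D l `+` D l.+1)) m)).
  apply: density_ratio_leI => x [DDx /= xm].
  have [xM|Mx] := ltnP x (M j); [by left|right].
  have jl := lev_ge _ _ Mx.
  have [l /andP[jl' ll] Dx] : exists2 l, (j <= l < lev x)%N & (D l `+` D l.+1) x.
    by apply: setY_telescope => //; rewrite !setY_def in DDx *.
  have lev0 : (0 < lev x)%N by exact: leq_ltn_trans ll.
  rewrite -bigcup_seq_cond; exists l => //=.
  have Mlx : (M l <= x)%N by rewrite (leq_trans _ (lev_le _ lev0))// Mle// ltnW.
  rewrite mem_index_iota jl' /= (leq_ltn_trans _ xm) ?(leq_trans (Mge l))//.
  by rewrite (leq_trans Mlx)// ltnW.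
apply: le_trans (density_ratioU _ _ _ _) _.
(* one [2 ^- j] pays for the finite segment below [M j], two for the tail *)
have -> : 3 * 2 ^- j = 2 ^- j + 2 * 2 ^- j :> R by lra.
apply: lerD.
  by near: m; apply: finite_density_ratio => //; exact: finite_II.
apply: le_trans (density_ratio_bigU _ _ _ _) _.
apply: (@le_trans _ _ (\sum_(j <= l < m | (M l <= m)%N) 2 ^- l)).
  by apply: ler_sum => l Mlm; apply: HN; exact: leq_trans Mlm.
apply: le_trans (sum_half_le j m).
rewrite big_mkcond; apply: ler_sum => l _; case: ifP => //.
Unshelve. all: by end_near. Qed.

End Completeness.

(** * Extending a density-preserving map to the measure algebra *)

Lemma setYCC (U : Type) (A B : set U) : ~` A `+` ~` B = A `+` B.
Proof. by rewrite !setY_def !setDE !setCK setUC (setIC _ A) (setIC _ B). Qed.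

Lemma setYUU (U : Type) (A B C D : set U) :
  (A `|` B) `+` (C `|` D) `<=` (A `+` C) `|` (B `+` D).
Proof.
rewrite !setY_def => x; rewrite /setD/=.
by have [?|?] := pselect (A x); have [?|?] := pselect (B x);
 have [?|?] := pselect (C x); have [?|?] := pselect (D x); tauto.
Qed.

(** The general extension principle: a sequence of points whose hitting
    frequencies are correct on an algebra [G] of test sets that is dense in
    the measure algebra induces a density-preserving embedding. *)
Section Embedding.
Context (R : realType) (d : measure_display) (T : measurableType d).
Variables (mu : {measure set T -> \bar R}) (f : nat -> T) (G : set (set T)).
Hypothesis mu_fin : (mu setT < +oo)%E.
Hypothesis GM : forall C, G C -> measurable C.
Hypothesis GC : forall C, G C -> G (~` C).
Hypothesis GU : forall C D, G C -> G D -> G (C `|` D).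
Hypothesis Gdensity : forall C, G C -> has_density (f @^-1` C) (mu C).
Hypothesis Gdense : forall B (e : R), measurable B -> 0 < e ->
  exists2 C, G C & (mu (B `+` C) <= e%:E)%E.

(** [A] plays the role of the value at [B] of the continuous extension of
    [C |-> f @^-1` C] from [G] to all measurable sets; it is only determined up
    to density zero, hence a relation. *)
Definition approximates (B : set T) (A : set nat) := forall e : R, 0 < e ->
  exists C, [/\ G C, (mu (B `+` C) <= e%:E)%E &
    \forall n \near \oo, density_ratio R (A `+` f @^-1` C) n <= e].

Lemma measurableY (A B : set T) : measurable A -> measurable B ->
  measurable (A `+` B).
Proof. by move=> mA mB; rewrite setY_def; apply: measurableU; apply: measurableD. Qed.

Lemma GY C D : G C -> G D -> G (C `+` D).
Proof.
move=> GCx GDx; rewrite setY_def !setDE -[C `&` _]setCK -[D `&` _]setCK !setCI !setCK.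
by apply: (GU (GC (GU (GC _) _)) (GC (GU (GC _) _))).
Qed.

Lemma approximatesC B A : approximates B A -> approximates (~` B) (~` A).
Proof.
move=> BA e e0; have [C [GCx BC AC]] := BA e e0; exists (~` C).
by split; [exact: GC|rewrite setYCC|rewrite preimage_setC setYCC].
Qed.

Lemma approximatesU B B' A A' : measurable B -> measurable B' ->
  approximates B A -> approximates B' A' -> approximates (B `|` B') (A `|` A').
Proof.
move=> mB mB' BA BA' e e0; have e2 : 0 < e / 2 by rewrite divr_gt0.
have [C [GCx BC AC]] := BA _ e2; have [C' [GCx' BC' AC']] := BA' _ e2.
exists (C `|` C'); split; first exact: GU.
- have -> : e%:E = ((e / 2)%:E + (e / 2)%:E)%E by rewrite -EFinD -splitr.
  have [mC mC'] := (GM GCx, GM GCx').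
  apply: le_trans (leeD BC BC'); apply: le_trans (measureU2 _ _ _).
  + apply: le_measure; last exact: setYUU; rewrite inE;
      [apply: measurableY; exact: measurableU|apply: measurableU; exact: measurableY].
  + exact: measurableY.
  + exact: measurableY.
- near=> n; rewrite [leRHS]splitr preimage_setU.
  apply: le_trans (density_ratio_le _ _ (@setYUU _ _ _ _ _)) _.
  apply: le_trans (density_ratioU _ _ _ _) (lerD _ _).
  + by near: n.
  + by near: n.
Unshelve. all: by end_near. Qed.

Lemma approximatesI B B' A A' : measurable B -> measurable B' ->
  approximates B A -> approximates B' A' -> approximates (B `&` B') (A `&` A').
Proof.
move=> mB mB' BA BA'; rewrite -[B `&` _]setCK -[A `&` _]setCK !setCI.
apply/approximatesC/approximatesU; [exact: measurableC|exact: measurableC| |];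
  exact: approximatesC.
Qed.

Lemma approximatesY B B' A A' : measurable B -> measurable B' ->
  approximates B A -> approximates B' A' -> approximates (B `+` B') (A `+` A').
Proof.
move=> mB mB' BA BA'; rewrite !setY_def !setDE.
have [mnB mnB'] := (measurableC mB, measurableC mB').
by apply: approximatesU; [exact: measurableI|exact: measurableI| |];
  apply: approximatesI => //; apply: approximatesC.
Qed.

Lemma mu_fin_num B : measurable B -> mu B \is a fin_num.
Proof.
move=> mB; rewrite ge0_fin_numE//; apply: le_lt_trans mu_fin.
by apply: le_measure; rewrite ?inE.
Qed.

Lemma fine_mu_dist B C : measurable B -> measurable C ->
  `|fine (mu B) - fine (mu C)| <= fine (mu (B `+` C)).
Proof.
have H X Y : measurable X -> measurable Y ->
    fine (mu X) <= fine (mu Y) + fine (mu (X `+` Y)).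
  move=> mX mY; have mXY := measurableY mX mY.
  rewrite -lee_fin EFinD !fineK; try exact: mu_fin_num.
  apply: le_trans (measureU2 _ _ _) => //.
  apply: le_measure; rewrite ?inE//; first exact: measurableU.
  rewrite setY_def => x Xx; have [Yx|nYx] := pselect (Y x); [by left|by right; left].
move=> mB mC; rewrite ler_distl; apply/andP; split; last exact: H.
by rewrite lerBlDr setYC H.
Qed.

(** On [G] the density of the preimage is the measure, and both sides are
    Lipschitz for the respective symmetric-difference pseudometrics. *)
Lemma approximates_density B A : measurable B -> approximates B A ->
  has_density A (mu B).
Proof.
move=> mB BA; rewrite -(fineK (mu_fin_num mB)); apply/has_density_fin.
apply/cvgrPdist_le => e e0; have e3 : 0 < e / 3 by rewrite divr_gt0.
have [C [GCx BC AC]] := BA _ e3; have mC := GM GCx.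
have := Gdensity GCx; rewrite -(fineK (mu_fin_num mC)) => /has_density_fin.
move=> /cvgrPdist_le/(_ _ e3) Cn; near=> n.
have AnC : density_ratio R (A `+` f @^-1` C) n <= e / 3 by near: n.
have Cen : `|fine (mu C) - density_ratio R (f @^-1` C) n| <= e / 3 by near: n.
have := le_trans (density_ratio_dist _ _ _ _) AnC.
have : `|fine (mu B) - fine (mu C)| <= e / 3.
  apply: le_trans (fine_mu_dist mB mC) _.
  by rewrite -lee_fin fineK//; apply: mu_fin_num; exact: measurableY.
move: Cen; rewrite !ler_norml => /andP[? ?] /andP[? ?] /andP[? ?].
by apply/andP; split; lra.
Unshelve. all: by end_near. Qed.

(** Test sets converging fast to [B] have preimages that are Cauchy in upper
    density, because the symmetric difference of two test sets is again a test
    set; completeness provides the limit. *)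
Lemma approximates_exists B : measurable B -> exists A, approximates B A.
Proof.
move=> mB.
have /choice[C HC] : forall n, exists C, G C /\ (mu (B `+` C) <= (2 ^- n.+2)%:E)%E.
  move=> n; have [|C ? ?] := @Gdense B (2 ^- n.+2) mB; last by exists C.
  by rewrite invr_gt0 exprn_gt0.
pose D n := f @^-1` (C n).
have pow0 n : 0 < 2 ^- n :> R by rewrite invr_gt0 exprn_gt0.
(* [2 ^- n] is made up of two errors [2 ^- n.+2] in measure and an error
   [2 ^- n.+1] in the frequency of the test set [C n `+` C n.+1] *)
have [|A HA] := @upper_density_complete R D.
  move=> n; have [[GCn muCn] [GCn1 muCn1]] := (HC n, HC n.+1).
  have mC := GM GCn; have mC1 := GM GCn1; have mY := measurableY mC mC1.
  have GYn := GY GCn GCn1.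
  have := Gdensity GYn; rewrite -(fineK (mu_fin_num mY)) => /has_density_fin.
  move=> /cvgrPdist_le/(_ _ (pow0 n.+1)) cvgD.
  have muY : fine (mu (C n `+` C n.+1)) <= 2 ^- n.+1.
    rewrite -lee_fin fineK; last exact: mu_fin_num.
    have -> : (2 ^- n.+1)%:E = ((2 ^- n.+2)%:E + (2 ^- n.+2)%:E)%E :> \bar R.
      by rewrite -EFinD !exprS !invfM//; congr EFin; lra.
    have mBC := measurableY mB mC; have mBC1 := measurableY mB mC1.
    apply: le_trans (leeD muCn (le_trans muCn1 _)).
      apply: le_trans (measureU2 _ mBC mBC1).
      apply: le_measure; rewrite ?inE//; first exact: measurableU.
      rewrite !setY_def => x; rewrite /setD/=.
      by have [?|?] := pselect (B x); have [?|?] := pselect (C n x);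
        have [?|?] := pselect (C n.+1 x); tauto.
    rewrite lee_fin lef_pV2 ?posrE ?exprn_gt0//.
    by rewrite ler_eXn2l// ltr1n.
  near=> m.
  have : `|fine (mu (C n `+` C n.+1)) - density_ratio R (f @^-1` (C n `+` C n.+1)) m|
     <= 2 ^- n.+1 by near: m.
  rewrite ler_norml => /andP[? ?].
  suff -> : D n `+` D n.+1 = f @^-1` (C n `+` C n.+1).
    by have : 2 ^- n = 2 * 2 ^- n.+1 :> R; [rewrite exprS invfM//; lra|lra].
  by rewrite !setY_def.
exists A => e e0.
have [n ne] : exists n, 3 * 2 ^- n <= e.
  have e3 : 0 < e / 3 by rewrite divr_gt0.
  have [n _ /(_ n (leqnn n))] := near_infty_natSinv_expn_lt (PosNum e3).
  by rewrite /= => ne; exists n; lra.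
exists (C n); have [GCn muCn] := HC n; split => //.
  apply: le_trans muCn _; rewrite lee_fin; apply: le_trans ne.
  by rewrite !exprS !invfM//; have := pow0 n; lra.
by apply: filterS (HA n) => m /le_trans; exact.
Unshelve. all: by end_near. Qed.

(** Both equalities of classes say that a symmetric difference is null, and
    these two symmetric differences approximate each other. The implication
    from left to right makes the embedding well defined, the other one makes
    it injective. *)
Lemma approximates_eq (B B' : measurable_sets T) (A A' : set nat) :
  approximates B A -> approximates B' A' ->
  (\pi_(measure_algebra mu) B = \pi_(measure_algebra mu) B')%qT <->
  (\pi_(density_algebra R) A = \pi_(density_algebra R) A')%qT.
Proof.
move=> BA BA'; have [mB mB'] := (msetP B, msetP B').
have dY := approximates_density (measurableY mB mB') (approximatesY mB mB' BA BA').
have -> : (\pi_(measure_algebra mu) B = \pi_(measure_algebra mu) B')%qT <->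
    mu (B `+` B') = 0%E.
  rewrite setY_def; split => [/eqmodP/asboolP//|muY].
  by apply/eqmodP/asboolP.
have -> : (\pi_(density_algebra R) A = \pi_(density_algebra R) A')%qT <->
    has_density (A `+` A') (0%E : \bar R).
  rewrite setY_def; split => [/eqmodP/asboolP//|dA].
  by apply/eqmodP/asboolP.
split=> [<-//|d0]; exact: has_density_unique dY d0.
Qed.

Lemma density_embedding :
  exists phi : measure_algebra mu -> density_algebra R, boolean_embedding phi /\
    forall a, algebra_has_density (phi a) (algebra_measure a).
Proof.
have /choice[A HA] : forall B : measurable_sets T, exists A, approximates B A.
  by move=> B; exact: approximates_exists (msetP B).
pose phi (a : measure_algebra mu) : density_algebra R :=
  (\pi_(density_algebra R) (A (repr a)))%qT.
have phiE (B : measurable_sets T) (X : set nat) : approximates B X ->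
    phi (\pi_(measure_algebra mu) B)%qT = (\pi_(density_algebra R) X)%qT.
  by move=> BX; apply/(approximates_eq (HA _) BX); rewrite reprK.
have phiI : {morph phi : a b / (a `&` b)%O}.
  move=> a b; rewrite -[a]reprK -[b]reprK !(phiE _ _ (HA _)).
  rewrite -[LHS]/(phi (quot_meet _ _)) -pi_quot_meet.
  rewrite -[RHS]/(quot_meet _ _) -pi_quot_meet.
  by apply: phiE; exact: approximatesI (msetP _) (msetP _) (HA _) (HA _).
have phiU : {morph phi : a b / (a `|` b)%O}.
  move=> a b; rewrite -[a]reprK -[b]reprK !(phiE _ _ (HA _)).
  rewrite -[LHS]/(phi (quot_join _ _)) -pi_quot_join.
  rewrite -[RHS]/(quot_join _ _) -pi_quot_join.
  by apply: phiE; exact: approximatesU (msetP _) (msetP _) (HA _) (HA _).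
have phiC : {morph phi : a / (~` a)%O}.
  move=> a; rewrite -[a]reprK (phiE _ _ (HA _)).
  rewrite -[LHS]/(phi (quot_compl _)) -pi_quot_compl.
  rewrite -[RHS]/(quot_compl _) -pi_quot_compl.
  by apply: phiE; exact: approximatesC (HA _).
exists phi; split; first split => //.
- move=> a b; rewrite -[a]reprK -[b]reprK !(phiE _ _ (HA _)).
  by move/(approximates_eq (HA _) (HA _)).
- split; first by rewrite -(meetxC \bot%O) phiI phiC meetxC.
  by rewrite -(joinxC \top%O) phiU phiC joinxC.
- move=> a; rewrite -[a]reprK (phiE _ _ (HA _)) algebra_measureE.
  apply/algebra_has_densityE; exact: approximates_density (msetP _) (HA _).
Qed.

End Embedding.

(** * The Haar outer measure *)

(** Countable subadditivity for an arbitrary countable index set, obtained by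
    grouping the indices along an injection into [nat]. *)
Lemma outer_measure_countable (R : realType) (T : Type)
    (mu : {outer_measure set T -> \bar R}) (I : choiceType) (C : set I)
    (F : I -> set T) : countable C ->
  (mu (\bigcup_(i in C) F i) <= \esum_(i in C) mu (F i))%E.
Proof.
move=> /countable_injP[g ginj].
pose J n := C `&` g @^-1` [set n].
have CJ : C = \bigcup_n J n.
  by apply/seteqP; split=> [i Ci|i [n _ []]//]; exists (g i).
have trivJ : trivIset setT J.
  apply/trivIsetP => m n _ _ /eqP mn; rewrite -subset0 => i [[_ gm] [_ gn]].
  by apply: mn; rewrite -gm -gn.
rewrite [in leRHS]CJ esum_bigcupT//; last by move=> i; exact: outer_measure_ge0.
rewrite -nneseries_esumT; last first.
  by move=> n; apply: esum_ge0 => i _; exact: outer_measure_ge0.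
have -> : \bigcup_(i in C) F i = \bigcup_n \bigcup_(i in J n) F i.
  by rewrite -bigcup_bigcup -CJ.
apply: le_trans (outer_measure_sigma_subadditive _ _) _.
apply: lee_nneseries => [n _ _|n _]; first exact: outer_measure_ge0.
have [->|/set0P[i Ji]] := eqVneq (J n) set0.
  by rewrite bigcup_set0 outer_measure0 esum_set0.
have -> : J n = [set i].
  apply/seteqP; split => [k Jk|k -> //] /=.
  by case: Ji Jk => Ci <- [Ck]; apply: ginj; rewrite inE.
by rewrite bigcup_set1 esum_set1// outer_measure_ge0.
Qed.

Section Haar.
Context (K : choiceType) (R : realType).
Local Notation mu := (@haar_outer K R).
Local Notation w := (@basic_weight K R).
Local Open Scope ereal_scope.

Lemma haar_outer_basic s : mu (basic_set s) <= w s.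
Proof.
apply: ereal_inf_lbound; exists [set s]; last by rewrite esum_set1 ?basic_weight_ge0.
by split; [exact: countable1|rewrite bigcup_set1].
Qed.

(** A basic set either lies on one side of the hyperplane of a coordinate or
    is cut by it into two basic sets of half the weight. *)
Lemma haar_outer_split k s :
  mu (basic_set s `&` [set x | x k]) + mu (basic_set s `&` ~` [set x | x k]) <= w s.
Proof.
case sk : (s.[? k]%fmap) => [[]|].
- rewrite [X in _ + mu X](_ : _ = set0) ?haar_outer0 ?adde0.
    apply: le_trans (haar_outer_basic s); apply: le_haar_outer; exact: subIsetl.
  by rewrite -subset0 => x [/(_ _ _ sk) xk]; rewrite /= xk; exact.
- rewrite [X in mu X + _](_ : _ = set0) ?haar_outer0 ?add0e.
    apply: le_trans (haar_outer_basic s); apply: le_haar_outer; exact: subIsetl.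
  by rewrite -subset0 => x [/(_ _ _ sk) xk]; rewrite /= xk.
- have H b : mu (basic_set s `&` [set x | x k = b]) <= (2 ^- (#|` domf s|).+1)%:E.
    have -> : (2 ^- (#|` domf s|).+1)%:E = w s.[k <- b]%fmap.
      rewrite /basic_weight dom_setf cardfsU1.
      have -> // : k \notin domf s by rewrite -fndSome sk.
    apply: le_trans (haar_outer_basic _); apply: le_haar_outer => x [xs /= xk].
    move=> j c; rewrite fnd_set; case: eqP => [-> [<-]//|_]; exact: xs.
  have -> : w s = (2 ^- (#|` domf s|).+1)%:E + (2 ^- (#|` domf s|).+1)%:E.
    by rewrite -EFinD /basic_weight exprS invfM//; congr EFin; lra.
  apply: le_trans (leeD (H true) (H false)); apply: leeD; apply: le_haar_outer.
    by move=> x [].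
  by move=> x [xs xk]; split => //; apply/negbTE/negP.
Qed.

Definition coord_set k : set (cantor_cube K R) := [set x | x k].

(** Splitting each member of a cover along the hyperplane preserves the total
    weight, which is Caratheodory's criterion. *)
Lemma measurable_coord k : measurable (coord_set k).
Proof.
apply: le_caratheodory_measurable => X.
rewrite [leRHS]/= /haar_outer; apply: le_ereal_inf_tmp => _ [C [cC XC] <-].
have H (A : set (K -> bool)) :
    mu (X `&` A) <= \esum_(s in C) mu (basic_set s `&` A).
  apply: le_trans (outer_measure_countable _ _ cC).
  by apply: le_haar_outer => x [/XC[s Cs sx] Ax]; exists s.
apply: le_trans (leeD (H _) (H _)) _.
rewrite -esumD; [|by move=> *; exact: haar_outer_ge0..].
by apply: le_esum => s _; exact: haar_outer_split.
Qed.

Lemma haar_outerT : mu setT <= 1.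
Proof.
apply: le_trans (le_trans (haar_outer_basic [fmap]%fmap) _).
  by apply: le_haar_outer => x _ k b; rewrite fnd_fmap0.
by rewrite /basic_weight cardfs0 expr0 invr1.
Qed.

End Haar.

(** The points of [cantor_cube], with the product topology. *)
Definition bool_power (K : Type) : Type := prod_topology (fun _ : K => bool).
HB.instance Definition _ K := Pointed.on (bool_power K).
HB.instance Definition _ K := Nbhs.on (bool_power K).
HB.instance Definition _ K := Topological.on (bool_power K).

Lemma bool_power_compact (K : choiceType) : compact [set: bool_power K].
Proof.
have := @tychonoff K (fun=> bool) _ (fun=> bool_compact).
by congr (compact _); rewrite eqEsubset.
Qed.

Lemma clopen_coord (K : choiceType) k : clopen ([set x | x k] : set (bool_power K)).
Proof.
have ck : continuous (fun x : bool_power K => (x k : bool)).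
  exact: (@proj_continuous K (fun=> bool) k).
split.
- apply: (@open_comp (bool_power K) bool (fun x => x k) [set b | b]).
    by move=> x _; exact: ck.
  exact: discrete_open.
- apply: (@closed_comp (bool_power K) bool (fun x => x k) [set b | b]).
    by move=> x _; exact: ck.
  exact: discrete_closed.
Qed.

(** * Clopen sets as test sets *)

Section Clopen.
Context (K : choiceType) (R : realType).
Local Notation mu := (haar_measure K R).
Local Notation w := (@basic_weight K R).

(** Clopen sets are used rather than explicit finite unions of basic sets because
    stability under complement is then immediate, and because closedness is
    what compactness arguments need. *)
Definition measurable_clopen : set (set (cantor_cube K R)) :=
  [set C : set (cantor_cube K R) | clopen (C : set (bool_power K)) /\ measurable C].

Lemma measurable_clopenC (C : set (cantor_cube K R)) :
  measurable_clopen C -> measurable_clopen (~` C).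
Proof. by move=> [cC mC]; split; [exact: clopenC|exact: measurableC]. Qed.

Lemma measurable_clopenU (C D : set (cantor_cube K R)) :
  measurable_clopen C -> measurable_clopen D -> measurable_clopen (C `|` D).
Proof. by move=> [? ?] [? ?]; split; [exact: clopenU|exact: measurableU]. Qed.

Lemma measurable_clopenI (C D : set (cantor_cube K R)) :
  measurable_clopen C -> measurable_clopen D -> measurable_clopen (C `&` D).
Proof. by move=> [? ?] [? ?]; split; [exact: clopenI|exact: measurableI]. Qed.

Lemma measurable_clopen0 : measurable_clopen set0.
Proof. by split; [exact: clopen0|exact: measurable0]. Qed.

Lemma measurable_clopenT : measurable_clopen setT.
Proof. by split; [exact: clopenT|exact: measurableT]. Qed.

Lemma measurable_clopen_basic s : measurable_clopen (basic_set s).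
Proof.
have mcH k : measurable_clopen (@coord_set K R k).
  by split; [exact: clopen_coord|exact: measurable_coord].
pose F k : set (cantor_cube K R) := [set x | forall b, s.[? k]%fmap = Some b -> x k = b].
have -> : basic_set s = \big[setI/setT]_(k <- domf s) F k.
  rewrite -bigcap_seq; apply/seteqP; split => [x xs k _ b|x xs k b sk]; first exact: xs.
  by apply: (xs k _ b sk) => /=; rewrite -fndSome sk.
apply: big_ind => [| |k _]; [exact: measurable_clopenT|exact: measurable_clopenI|].
case sk : (s.[? k]%fmap) => [[]|].
- have -> : F k = @coord_set K R k; last exact: mcH.
  apply/seteqP; split => x; rewrite /F /coord_set/= sk.
    by move/(_ _ erefl).
  by move=> xk b [<-].
- have -> : F k = ~` @coord_set K R k; last exact: measurable_clopenC.
  apply/seteqP; split => x; rewrite /F /coord_set/= sk.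
    by move=> /(_ _ erefl) xk; rewrite /setC/= xk.
  by move=> xk b [<-]; apply/negbTE/negP.
- have -> : F k = setT; last exact: measurable_clopenT.
  by apply/seteqP; split => x // _ b; rewrite sk.
Qed.

Lemma haar_fin_num (X : set (K -> bool)) : haar_outer R X \is a fin_num.
Proof.
rewrite ge0_fin_numE ?haar_outer_ge0//; apply: le_lt_trans (ltry 1).
by apply: le_trans (haar_outerT K R); exact: le_haar_outer.
Qed.

Lemma haar_outer_cover (X : set (K -> bool)) (e : R) : 0 < e ->
  exists C : set {fmap K -> bool},
  [/\ countable C, X `<=` \bigcup_(s in C) basic_set s &
   (\esum_(s in C) w s <= haar_outer R X + e%:E)%E].
Proof.
move=> e0; have [_ [C [cC XC] <-] /ltW CX] := lb_ereal_inf_adherent e0 (haar_fin_num X).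
by exists C.
Qed.

(** A cover of [B] of almost minimal weight has a union [U] close to [B], and
    finite subunions, which are clopen, exhaust [U]. *)
Lemma measurable_clopen_dense (B : set (cantor_cube K R)) (e : R) :
  measurable B -> 0 < e ->
  exists2 C, measurable_clopen C & (mu (B `+` C) <= e%:E)%E.
Proof.
move=> mB e0; have e2 : 0 < e / 2 by rewrite divr_gt0.
have [C [cC BC CB]] := haar_outer_cover B e2.
pose U : set (cantor_cube K R) := \bigcup_(s in C) basic_set s.
have [E EG UE] : exists2 E : (set (cantor_cube K R))^nat,
    (forall n, measurable_clopen (E n)) & U = \bigcup_n E n.
  have [C0|[g]] := pfcard_geP cC.
    exists (fun=> set0) => [_|]; first exact: measurable_clopen0.
    by rewrite /U C0 bigcup_set0 bigcup0.
  exists (fun n => basic_set (g n)) => [n|]; first exact: measurable_clopen_basic.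
  apply/seteqP; split => [x [s Cs sx]|x [n _ nx]].
    by have [n _ gn] := @surj _ _ _ _ g _ Cs; exists n => //; rewrite gn.
  by exists (g n) => //; exact: funS.
pose F n := \big[setU/set0]_(i < n.+1) E i.
have FG n : measurable_clopen (F n).
  by apply: big_ind => //; [exact: measurable_clopen0|exact: measurable_clopenU].
have mF n : measurable (F n) by have [] := FG n.
have UF : U = \bigcup_n F n by rewrite UE bigcup_bigsetU_bigcup.
have mU : measurable U by rewrite UE; apply: bigcup_measurable => n _; have [] := EG n.
have muU : (mu U <= mu B + (e / 2)%:E)%E.
  by apply: le_trans CB; apply: ereal_inf_lbound; exists C => //; split.
have ndF : nondecreasing_seq F.
  apply/nondecreasing_seqP => n; rewrite /F [leRHS]big_ord_recr.
  by apply/subsetPset; exact: subsetUl.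
have cvgF : mu (F n) @[n --> \oo] --> mu U.
  by rewrite UF; apply: nondecreasing_cvg_mu => //; rewrite -UF.
have finmu X : mu X \is a fin_num by exact: haar_fin_num.
have [n Fn] : exists n, (mu U - (e / 2)%:E <= mu (F n))%E.
  have := cvgF; rewrite -(fineK (finmu U)) => /fine_cvgP[_].
  move=> /cvgrPdist_le/(_ _ e2)[n _ /(_ n (leqnn n))].
  rewrite ler_norml => /andP[_ /=]; exists n.
  by rewrite -(fineK (finmu U)) -(fineK (finmu (F n))) -EFinB lee_fin; lra.
exists (F n) => //.
have BU : B `<=` U by [].
have FU : F n `<=` U by rewrite UF; exact: bigcup_sup.
apply: (@le_trans _ _ (mu ((U `\` F n) `|` (U `\` B)))).
  apply: le_measure; rewrite ?inE.
  - by rewrite setY_def; apply: measurableU; exact: measurableD.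
  - by apply: measurableU; exact: measurableD.
  - rewrite setY_def => x [[Bx nF]|[Fx nB]].
      by left; split => //; exact: BU.
    by right; split => //; exact: FU.
have -> : e%:E = ((e / 2)%:E + (e / 2)%:E)%E by rewrite -EFinD -splitr.
have muoo X : (mu X < +oo)%E by rewrite ltey_eq finmu.
apply: le_trans (measureU2 _ _ _) _; [exact: measurableD|exact: measurableD|].
rewrite (measureD mU (mF n) (muoo U)) (measureD mU mB (muoo U)).
rewrite (setIidr FU) (setIidr BU).
have UB : (mu U - mu B <= (e / 2)%:E)%E by rewrite leeBlDl.
have UFn : (mu U - mu (F n) <= (e / 2)%:E)%E.
  move: Fn; rewrite -(fineK (finmu U)) -(fineK (finmu (F n))) -!EFinB !lee_fin.
  lra.
exact: leeD UFn UB.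
Qed.
End Clopen.

(** * Sequences with correct frequencies on basic sets *)

Section UniformDistribution.
Context (K : choiceType) (R : realType).
Local Notation mu := (haar_measure K R).
Variable f : nat -> cantor_cube K R.
Hypothesis f_basic : forall (s : {fmap K -> bool}) (e : R), 0 < e ->
  \forall n \near \oo, density_ratio R (f @^-1` basic_set s) n <= 2 ^- #|` domf s| + e.

Lemma density_ratio_cover (r : seq {fmap K -> bool}) (e : R) : 0 < e ->
  \forall n \near \oo,
    density_ratio R (\big[setU/set0]_(s <- r) (f @^-1` basic_set s)) n
      <= \sum_(s <- r) 2 ^- #|` domf s| + e.
Proof.
elim: r e => [|s r IH] e e0.
  apply: nearW => n; rewrite !big_nil add0r.
  by rewrite density_ratioE big1 ?mul0r ?ltW// => i _; rewrite in_set0.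
have e2 : 0 < e / 2 by rewrite divr_gt0.
have Hr := IH _ e2; have Hs := f_basic s e2; near=> n.
rewrite !big_cons; apply: le_trans (density_ratioU _ _ _ _) _.
rewrite [in leRHS](splitr e) addrACA; apply: lerD; first by near: n.
by near: n.
Unshelve. all: by end_near. Qed.

(** By compactness a cover of [C] by basic sets may be taken finite, so its
    total weight bounds the frequency of visits to [C] asymptotically. *)
Lemma closed_density_ratio (C : set (cantor_cube K R)) (e : R) :
  closed (C : set (bool_power K)) -> 0 < e ->
  \forall n \near \oo, density_ratio R (f @^-1` C) n <= fine (mu C) + e.
Proof.
move=> clC e0; have e2 : 0 < e / 2 by rewrite divr_gt0.
have [S [_ CS Smu]] := haar_outer_cover C e2.
have : compact (C : set (bool_power K)).
  by apply: subclosed_compact clC (@bool_power_compact K) _.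
rewrite compact_cover => /(_ _ S (fun s => basic_set s : set (bool_power K))).
case=> [s _|//|D DS CD].
  by have [[]] := measurable_clopen_basic R s.
have Hn := density_ratio_cover D e2; near=> n.
apply: (@le_trans _ _ (\sum_(s <- D) 2 ^- #|` domf s| + e / 2)).
  apply: (@le_trans _ _ (density_ratio R
    (\big[setU/set0]_(s <- D) (f @^-1` basic_set s)) n)); last by near: n.
  apply: density_ratio_le => x /CD[s Ds sx]; rewrite -bigcup_seq; exists s => //.
rewrite [in leRHS](splitr e) addrA lerD2r -lee_fin EFinD fineK; last exact: haar_fin_num.
apply: le_trans Smu; apply: esum_ge; exists [set` D].
  by split; [exact: finite_fset|move=> s /DS; rewrite inE].
by rewrite fsbig_finite//= set_fsetK sumEFin.
Unshelve. all: by end_near. Qed.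

(** The upper bound for closed sets applies to [C] and to its complement, and
    the two bounds add up to at most [1]. *)
Lemma clopen_has_density (C : set (cantor_cube K R)) :
  measurable_clopen C -> has_density (f @^-1` C) (mu C).
Proof.
move=> mcC; have [[_ clC] mC] := mcC.
have [[_ clnC] mnC] := measurable_clopenC mcC.
have finmu X : mu X \is a fin_num by exact: haar_fin_num.
rewrite -(fineK (finmu C)); apply/has_density_fin/cvgrPdist_le => e e0.
have muC1 : fine (mu C) + fine (mu (~` C)) <= 1.
  rewrite -lee_fin EFinD !fineK//; apply: le_trans (haar_outerT K R).
  by rewrite -[X in haar_outer _ X](setUv C) -[leRHS]/(mu _) measureU// setICr.
have HC := closed_density_ratio clC e0; have HnC := closed_density_ratio clnC e0.
near=> n; have n0 : (0 < n)%N by near: n; exact: nbhs_infty_gt.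
have : density_ratio R (f @^-1` C) n <= fine (mu C) + e by near: n.
have : density_ratio R (f @^-1` (~` C)) n <= fine (mu (~` C)) + e by near: n.
rewrite preimage_setC density_ratioC// ler_norml => ? ?; apply/andP; split; lra.
Unshelve. all: by end_near. Qed.

Lemma haar_density_embedding :
  exists phi : measure_algebra mu -> density_algebra R, boolean_embedding phi /\
    forall a, algebra_has_density (phi a) (algebra_measure a).
Proof.
apply: (@density_embedding R _ _ mu f (@measurable_clopen K R)).
- by apply: le_lt_trans (haar_outerT K R) _; rewrite ltry.
- by move=> C [].
- exact: measurable_clopenC.
- exact: measurable_clopenU.
- exact: clopen_has_density.
- by move=> B e; exact: measurable_clopen_dense.
Qed.
End UniformDistribution.

(** * A uniformly distributed sequence in the cube *)

Section FiniteCounting.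
Local Open Scope nat_scope.

Lemma sum_period p q (h : nat -> nat) :
  \sum_(q * p <= i < q.+1 * p) h (i %% p) = \sum_(i < p) h i.
Proof.
rewrite -{1}[q * p]add0n mulSn big_addn addnK big_mkord; apply: eq_bigr => i _.
by rewrite addnC modnMDl modn_small.
Qed.

(** Prescribing a boolean function at distinct points [g i] leaves it free on
    the other points, so each prescribed value halves the count. *)
Lemma card_ffun_agree (T I : finType) (g : I -> T) (v : I -> bool) : injective g ->
  #|[pred h : {ffun T -> bool} | [forall i, h (g i) == v i]]| * 2 ^ #|I| = 2 ^ #|T|.
Proof.
move=> ginj.
pose F t := [pred b : bool | [forall i, (g i == t) ==> (b == v i)]].
rewrite (_ : #|_| = #|family F|); last first.
  apply: eq_card => h; rewrite !inE; apply/forallP/familyP => [H t|H i].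
    by rewrite inE; apply/forallP => i; apply/implyP => /eqP <-.
  by have := H (g i); rewrite inE => /forallP/(_ i)/implyP/(_ (eqxx _)).
rewrite card_family foldrE big_image/=.
have -> : 2 ^ #|I| = \prod_t (if t \in codom g then 2 else 1).
  by rewrite -big_mkcond prod_nat_const card_codom.
rewrite -big_split/= (eq_bigr (fun=> 2)) ?prod_nat_const// => t _.
case: ifPn => [/codomP[i ->]|tg].
  rewrite (_ : #|_| = 1)// -(card1 (v i)); apply: eq_card => b; rewrite !inE.
  apply/forallP/eqP => [/(_ i)/implyP/(_ (eqxx _))/eqP//|-> j].
  by apply/implyP => /eqP/ginj ->.
rewrite (_ : #|_| = 2)// -card_bool; apply: eq_card => b; rewrite !inE.
by apply/forallP => i; apply/implyP => /eqP gi; rewrite -gi codom_f in tg.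
Qed.

End FiniteCounting.

Section PointSequence.
Local Open Scope nat_scope.
Context (K : choiceType) (e : K -> nat -> bool).
Hypothesis e_inj : injective e.

Definition initial_bits k x : k.-tuple bool := [tuple e x i | i < k].

(** The double logarithm keeps the period [2 ^ 2 ^ k] of stage [k] at or below
    the square root of every [n >= 4] of level [k], while stage boundaries
    remain multiples of the periods on both sides. *)
Definition level n := trunc_log 2 (trunc_log 4 n).

Definition patterns k := {ffun k.-tuple bool -> bool}.

(** At stage [k] the points run periodically through all boolean functions of
    the first [k] bits of the coordinate; coordinates already separated by
    these bits then behave like independent fair coins. *)
Definition stage_point n : K -> bool := fun x =>
  nth [ffun=> false] (enum {: patterns (level n)}) (n %% 2 ^ 2 ^ level n)
    (initial_bits (level n) x).

Lemma card_patterns k : #|{: patterns k}| = 2 ^ 2 ^ k.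
Proof. by rewrite card_ffun card_bool card_tuple card_bool. Qed.

Lemma level_eq k n : 4 ^ 2 ^ k <= n < 4 ^ 2 ^ k.+1 -> level n = k.
Proof.
move=> /andP[kn nk]; apply: trunc_log_eq => //.
rewrite trunc_log_max//= -(ltn_exp2l _ _ (isT : 1 < 4)).
apply: leq_ltn_trans nk; apply: trunc_logP => //.
by apply: leq_trans kn; rewrite expn_gt0.
Qed.

(** A basic set constrains finitely many coordinates, so from some stage on
    their initial bits tell them apart. *)
Lemma initial_bits_inj (s : {fset K}) : exists k0, forall k, k0 <= k ->
  injective (fun x : s => initial_bits k (val x)).
Proof.
have [g gP] : exists g : s * s -> nat, forall xy, xy.1 != xy.2 ->
    e (val xy.1) (g xy) != e (val xy.2) (g xy).
  suff /choice : forall xy : s * s, exists i, xy.1 != xy.2 -> e (val xy.1) i != e (val xy.2) i.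
    by case=> g gP; exists g.
  case=> x y /=; case: eqVneq => [_|/eqP xy]; first by exists 0.
  apply: contrapT => H; apply: xy; apply/val_inj/e_inj/funext => i.
  by apply/eqP/negPn/negP => xyi; apply: H; exists i.
exists (\max_xy (g xy).+1) => k k0k x y /= xy; apply/eqP/negPn/negP => /(gP (x, y)) /=.
have gk : g (x, y) < k by apply: leq_trans k0k; exact: (@leq_bigmax _ (fun xy => (g xy).+1)).
by have /(congr1 (fun t => tnth t (Ordinal gk))) := xy; rewrite !tnth_mktuple => ->; rewrite eqxx.
Qed.

Variable s : {fmap K -> bool}.
Let A : set nat := stage_point @^-1` basic_set s.
Local Notation N := (2 ^ #|` domf s|).

(** Within a stage, one period lists each pattern once. *)
Lemma block_count k q : injective (fun x : domf s => initial_bits k (val x)) ->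
  4 ^ 2 ^ k <= q * 2 ^ 2 ^ k -> q.+1 * 2 ^ 2 ^ k <= 4 ^ 2 ^ k.+1 ->
  N * \sum_(q * 2 ^ 2 ^ k <= i < q.+1 * 2 ^ 2 ^ k) (i \in A) = 2 ^ 2 ^ k.
Proof.
move=> kinj kq qk.
pose P := [pred h : patterns k | [forall x : domf s, h (initial_bits k (val x)) == s x]].
pose h i : nat := nth [ffun=> false] (enum {: patterns k}) i \in P.
have -> : \sum_(q * 2 ^ 2 ^ k <= i < q.+1 * 2 ^ 2 ^ k) (i \in A) =
    \sum_(q * 2 ^ 2 ^ k <= i < q.+1 * 2 ^ 2 ^ k) h (i %% 2 ^ 2 ^ k).
  apply: eq_big_nat => i /andP[qi iq]; congr nat_of_bool.
  have lk : level i = k.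
    by apply: level_eq; rewrite (leq_trans kq qi) (leq_trans iq qk).
  apply/idP/idP => [/set_mem|].
    rewrite /A /basic_set/= /stage_point lk => H; rewrite inE; apply/forallP => x.
    by apply/eqP; apply: H; rewrite Some_fnd.
  move=> Hi; apply/mem_set => x b; move: Hi; rewrite inE => /forallP H.
  rewrite /stage_point lk => sx.
  have xs : x \in domf s by rewrite -fndSome sx.
  have /eqP /= -> := H [` xs]%fset.
  by move: sx; rewrite in_fnd => -[].
rewrite sum_period.
have -> : \sum_(i < 2 ^ 2 ^ k) h i = #|P|.
  rewrite -(big_mkord xpredT h) -card_patterns [#|{: _}|]cardE.
  rewrite -(big_nth [ffun=> false] xpredT (fun x => x \in P : nat)) big_enum.
  by rewrite -sum1_card [in RHS]big_mkcond; apply: eq_bigr => x _; case: ifP.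
have := @card_ffun_agree _ _ (fun x : domf s => initial_bits k (val x)) (fun x => s x) kinj.
by rewrite mulnC cardfE card_tuple card_bool.
Qed.

(** From stage [k0] on, every complete period contributes exactly its fair
    share, and the boundaries of the stages fall between periods. What remains
    is a constant for the early stages and one unfinished period [p], which
    is at most the square root of [m]. *)
Lemma count_bound : exists C, forall m, C <= m -> exists2 p, p * p <= m &
  N * \sum_(0 <= i < m) (i \in A) <= N * C + m + p.
Proof.
have [k0 k0P] := initial_bits_inj (domf s).
pose p k := 2 ^ 2 ^ k.
have p_gt0 k : 0 < p k by rewrite expn_gt0.
have pS k : p k.+1 = p k * p k by rewrite /p expnS mulSn mul1n expnD.
have p4 k : 4 ^ 2 ^ k = p k * p k by rewrite -[4]/(2 * 2) expnMn.
exists (4 ^ 2 ^ k0).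
pose C := 4 ^ 2 ^ k0.
pose c m := \sum_(0 <= i < m) (i \in A).
(* counted in periods, stage [k] goes from [p k] to [p k ^ 3] *)
have grow k q : k0 <= k -> N * c (p k * p k) <= N * C + p k * p k ->
    p k <= q <= p k.+1 * p k -> N * c (q * p k) <= N * C + q * p k.
  move=> k0k base /andP[]; elim: q => [|q IHq].
    by rewrite leqn0 => /eqP; have := p_gt0 k; lia.
  rewrite leq_eqVlt => /predU1P[<- //|]; rewrite ltnS => kq qk.
  have /IHq/(_ (ltnW qk)) cq := kq.
  rewrite /c (@big_cat_nat _ _ _ (q * p k))//= ?leq_mul2r ?leqnSn ?orbT//.
  rewrite mulnDr block_count//; first by rewrite mulSn; move: cq; rewrite /c -/(p k); lia.
  - exact: k0P.
  - by rewrite p4 leq_mul2r kq orbT.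
  - by rewrite p4 {2}pS mulnA leq_mul2r qk orbT.
have base k : k0 <= k -> N * c (p k * p k) <= N * C + p k * p k.
  move=> k0k; rewrite -(subnK k0k); elim: (k - k0) => [|j IHj].
    rewrite add0n /C p4; apply: leq_trans (leq_addr _ _); rewrite leq_mul2l; apply/orP; right.
    apply: (@leq_trans (\sum_(0 <= i < p k0 * p k0) 1)).
      by apply: leq_sum => i _; exact: leq_b1.
    by rewrite sum_nat_const_nat muln1 subn0.
  have -> : p (j.+1 + k0) * p (j.+1 + k0) = p (j + k0).+1 * p (j + k0) * p (j + k0).
    by rewrite addSn {2}pS mulnA.
  apply: grow => //; first exact: leq_addl.
  by rewrite leqnn andbT pS -mulnA leq_pmulr// muln_gt0 !p_gt0.
move=> m Cm; pose k := level m.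
have t_gt0 : 0 < trunc_log 4 m by apply: leq_trans (trunc_log_max _ Cm); rewrite ?expn_gt0.
have m_gt0 : 0 < m by apply: leq_trans Cm; rewrite expn_gt0.
have km : p k * p k <= m.
  rewrite -p4; apply: leq_trans (trunc_logP (isT : 1 < 4) m_gt0).
  by rewrite leq_exp2l//; exact: trunc_logP.
have mk : m < p k.+1 * p k * p k.
  rewrite -mulnA -pS -p4; apply: leq_trans (trunc_log_ltn m (isT : 1 < 4)) _.
  by rewrite leq_exp2l//; exact: trunc_log_ltn.
have k0k : k0 <= k by rewrite !trunc_log_max.
exists (p k) => //.
have qk : p k <= (m %/ p k).+1 <= p k.+1 * p k.
  by rewrite leqW ?leq_divRL//= ltn_divLR.
have := grow _ _ k0k (base _ k0k) qk.
have mq : m <= (m %/ p k).+1 * p k by rewrite ltnW// -ltn_divLR.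
have : c m <= c ((m %/ p k).+1 * p k).
  by rewrite /c [leqRHS](@big_cat_nat _ _ _ m)//= leq_addr.
rewrite -(leq_pmul2l (_ : 0 < N)) ?expn_gt0// => cm /(leq_trans cm) /leq_trans; apply.
by rewrite mulSn -!addnA leq_add2l addnC leq_add2r leq_trunc_div.
Qed.

Local Open Scope ring_scope.

Lemma stage_point_basic (R : realType) (eps : R) : 0 < eps ->
  \forall n \near \oo, density_ratio R A n <= 2 ^- #|` domf s| + eps.
Proof.
move=> eps0; have [C HC] := count_bound.
have eps4 : 0 < eps / 4 by rewrite divr_gt0.
near=> n; have n0 : (0 < n)%N by near: n; exact: nbhs_infty_gt.
have [|p pn] := HC n; first by near: n; exact: nbhs_infty_ge.
rewrite big_mkord -(ler_nat R) !natrD !natrM => cn.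
have Cn : C%:R <= eps / 4 * n%:R :> R.
  by rewrite -ler_pdivrMl// mulrC; near: n; exact: nbhs_infty_ger.
have N0 : 0 < (2 ^ #|` domf s|)%N%:R :> R by rewrite ltr0n expn_gt0.
have N1 : 1 <= (2 ^ #|` domf s|)%N%:R :> R by rewrite ler1n expn_gt0.
have pn' : p%:R <= eps / 4 * n%:R :> R.
  (* [p] is either bounded by [4 / eps], or so large that [p * p <= n] wins *)
  have [pe|ep] := lerP p%:R (4 / eps).
    apply: le_trans pe _; rewrite -ler_pdivrMl// mulrC; near: n; exact: nbhs_infty_ger.
  have pnR : p%:R * p%:R <= n%:R :> R by rewrite -natrM ler_nat.
  rewrite ltr_pdivrMr// in ep; nra.
rewrite density_ratioE ler_pdivrMr ?ltr0n// -(ler_pM2l N0); apply: le_trans cn _.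
rewrite mulrDl mulrDr mulrA -natrX divff ?gt_eqF// mul1r.
have epsn0 : 0 <= eps / 4 * n%:R :> R by rewrite mulr_ge0// ltW.
have := ler_wpM2l (ltW N0) Cn.
have := ler_peMl epsn0 N1.
by lra.
Unshelve. all: by end_near. Qed.

End PointSequence.

Local Open Scope card_scope.

Theorem theorem3 (R : realType) (K : choiceType)
    (card_K : [set: K] #= [set: nat -> bool]) :
  exists phi : measure_algebra (haar_measure K R) -> density_algebra R,
    boolean_embedding phi /\
    forall a : measure_algebra (haar_measure K R),
      algebra_has_density (phi a) (algebra_measure a).
Proof.
have /card_eqPle[/pcard_injP[e e_inj] _] := card_K.
have {}e_inj : injective e by move=> x y; apply: e_inj; rewrite inE.
apply: (@haar_density_embedding K R (stage_point e)) => s eps.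
exact: stage_point_basic.
Qed.
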